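(* Let $p$ and $q$ be Hermitian symmetric polynomials on $\mathbf{C}^n$ with $\mathbf{r}(pq)=1$. Then $\mathbf{r}(p)=\mathbf{r}(q)=1$.
   Context: A Hermitian symmetric polynomial on $\mathbf{C}^n$ is a polynomial $p(z,\overline{w})=\sum_{\alpha,\beta}c_{\alpha\beta}z^\alpha\overline{w}^\beta$ (finite sum over multi-indices) whose coefficient matrix $(c_{\alpha\beta})$ is Hermitian; it is identified with the real-valued function $p(z,\overline z)$. The rank $\mathbf{r}(p)$ is the rank of the matrix $(c_{\alpha\beta})$. Products are ordinary products of polynomials. *)

(* Defs.v *)
From mathcomp Require Export all_boot all_order all_algebra.
From mathcomp Require Export reals complex mpoly.

Set Implicit Arguments.
Unset Strict Implicit.
Unset Printing Implicit Defensive.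

Import GRing.Theory.
Local Open Scope ring_scope.
Local Open Scope complex_scope.

(* A polynomial p(z, conj w) on C^n is an element of {mpoly R[i][n + n]}: the
   first n indeterminates stand for z, the last n for conj w. The multi-index
   mnm_pair a b is the exponent of z^a (conj w)^b. *)
Definition mnm_pair (n : nat) (a b : 'X_{1..n}) : 'X_{1..n + n} :=
  [multinom match split k with inl i => a i | inr j => b j end | k < n + n].

Definition bicoef (F : fieldType) (n : nat) (p : {mpoly F[n + n]})
  (a b : 'X_{1..n}) : F := p@_(mnm_pair a b).

Definition hermitian_symmetric (R : realType) (n : nat)
  (p : {mpoly R[i][n + n]}) : Prop :=
  forall a b : 'X_{1..n}, bicoef p b a = (bicoef p a b)^*.

(* The matrix (c_ab) has infinitely many rows and columns; it is cut down to the
   multi-indices of degree < msize p, outside of which it vanishes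
   (bicoef_eq0l and bicoef_eq0r below). *)
Definition coef_mx (F : fieldType) (n : nat) (p : {mpoly F[n + n]}) :
  'M[F]_#|{: 'X_{1..n < msize p}}| :=
  \matrix_(i, j) bicoef p (bmnm (enum_val i)) (bmnm (enum_val j)).

Definition mrank (F : fieldType) (n : nat) (p : {mpoly F[n + n]}) : nat :=
  \rank (coef_mx p).

Lemma mdeg_mnm_pair (n : nat) (a b : 'X_{1..n}) :
  mdeg (mnm_pair a b) = (mdeg a + mdeg b)%N.
Proof.
rewrite !mdegE big_split_ord /=; congr (_ + _)%N; apply: eq_bigr => i _.
  by rewrite mnmE (unsplitK (inl i)).
by rewrite mnmE (unsplitK (inr i)).
Qed.

Lemma mnm_pair_surj (n : nat) (m : 'X_{1..n + n}) :
  exists a b : 'X_{1..n}, m = mnm_pair a b.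
Proof.
exists [multinom m (lshift n i) | i < n], [multinom m (rshift n i) | i < n].
by apply/mnmP => k; rewrite mnmE; case: split_ordP => j ->; rewrite mnmE.
Qed.

Lemma bicoef_eq0l (F : fieldType) (n : nat) (p : {mpoly F[n + n]})
  (a b : 'X_{1..n}) : (msize p <= mdeg a)%N -> bicoef p a b = 0.
Proof.
move=> le_pa; apply/eqP; rewrite mcoeff_eq0; apply/negP => /msize_mdeg_lt.
by rewrite mdeg_mnm_pair ltnNge (leq_trans le_pa) // leq_addr.
Qed.

Lemma bicoef_eq0r (F : fieldType) (n : nat) (p : {mpoly F[n + n]})
  (a b : 'X_{1..n}) : (msize p <= mdeg b)%N -> bicoef p a b = 0.
Proof.
move=> le_pb; apply/eqP; rewrite mcoeff_eq0; apply/negP => /msize_mdeg_lt.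
by rewrite mdeg_mnm_pair ltnNge (leq_trans le_pb) // leq_addl.
Qed.

(* Main.v *)
(** Write p = p(z, w) with w standing for conj z.  The rank of a nonzero p is 1
    exactly when p(z, w) = a(z) b(w), so the claim is that the factors of a
    product A(z) B(w) again separate their variables.  The Kronecker
    substitution z_i := s^(N^i), w_j := t^(N^j), with N larger than all degrees
    involved, keeps the coefficient matrices intact and reduces this to
    polynomials in two variables s and t.  There B(t) is a product of linear
    factors t - r, and each of them divides P or Q in C[s][t] as soon as it
    divides P Q; once all of them are stripped off, P Q is a nonzero element of
    C[s], so what is left of P and Q is constant in t. *)
Require Import Defs.

Set Implicit Arguments.
Unset Strict Implicit.
Unset Printing Implicit Defensive.

Import GRing.Theory.
Local Open Scope ring_scope.

(** Base [N] digits are unique: the lowest digit is the residue modulo [N], and cancelling it and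
    dividing by [N] leaves a shorter expansion. *)
Lemma base_expansion_inj (N n : nat) (f g : 'I_n -> nat) :
  (forall i, (f i < N)%N) -> (forall i, (g i < N)%N) ->
  (\sum_(i < n) f i * N ^ i = \sum_(i < n) g i * N ^ i)%N -> f =1 g.
Proof.
elim: n f g => [|n IHn] f g ltf ltg; first by move=> _ [].
have shift (h : 'I_n.+1 -> nat) :
    (\sum_(i < n.+1) h i * N ^ i
     = (\sum_(i < n) h (lift ord0 i) * N ^ i) * N + h ord0)%N.
  rewrite big_ord_recl expn0 muln1 addnC big_distrl; congr (_ + _)%N.
  by apply: eq_bigr => i _; rewrite lift0 expnSr mulnA.
rewrite !shift => eq_fg.
have N_gt0 : (0 < N)%N by apply: leq_ltn_trans (ltf ord0).
have eq0 : f ord0 = g ord0.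
  by have := congr1 (modn^~ N) eq_fg; rewrite !modnMDl !modn_small.
move: eq_fg; rewrite eq0 => /addIn /eqP; rewrite eqn_pmul2r // => /eqP eq_fg i.
by case: (unliftP ord0 i) => [j ->|->] //; apply: (IHn _ _ _ _ eq_fg).
Qed.

Definition kronecker_exp (N n : nat) (a : 'X_{1..n}) : nat :=
  (\sum_(i < n) a i * N ^ i)%N.

(** A bound on the degree suffices, since it bounds every coordinate, that is, every digit. *)
Lemma kronecker_exp_inj (N n : nat) (a b : 'X_{1..n}) :
  (mdeg a < N)%N -> (mdeg b < N)%N ->
  kronecker_exp N a = kronecker_exp N b -> a = b.
Proof.
have coord_lt (c : 'X_{1..n}) i : (mdeg c < N -> c i < N)%N.
  by apply: leq_ltn_trans; rewrite mdegE (bigD1 i) //= leq_addr.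
move=> lta ltb /base_expansion_inj eqab; apply/mnmP; apply: eqab => i;
  exact: coord_lt.
Qed.

(* The polynomial variable of {poly {poly F}} replaces the w_j, that of the
   coefficients {poly F} replaces the z_i. *)
Definition kronecker_var (F : fieldType) (N n : nat) (k : 'I_(n + n)) :
    {poly {poly F}} :=
  match split k with inl i => ('X^(N ^ i))%:P | inr j => 'X^(N ^ j) end.

Definition kronecker (F : fieldType) (N n : nat) :
    {rmorphism {mpoly F[n + n]} -> {poly {poly F}}} :=
  mmap (polyC \o polyC) (@kronecker_var F N n).

Lemma kroneckerX (F : fieldType) (N n : nat) (a b : 'X_{1..n}) :
  kronecker F N n 'X_[mnm_pair a b]
  = ('X^(kronecker_exp N a))%:P * 'X^(kronecker_exp N b).
Proof.
rewrite /kronecker /= mmapX /mmap1 big_split_ord /=.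
congr (_ * _).
  rewrite rmorphXn /= -prodrXr; apply: eq_bigr => i _.
  by rewrite mnmE /kronecker_var (unsplitK (inl i)) rmorphXn /= -exprM mulnC.
rewrite -prodrXr; apply: eq_bigr => i _.
by rewrite mnmE /kronecker_var (unsplitK (inr i)) -exprM mulnC.
Qed.

Definition mx_mnm (F : fieldType) (n : nat) (p : {mpoly F[n + n]})
  (i : 'I_#|{: 'X_{1..n < msize p}}|) : 'X_{1..n} := bmnm (enum_val i).
Arguments mx_mnm {F n} p i.

Lemma mx_mnm_inj (F : fieldType) (n : nat) (p : {mpoly F[n + n]}) :
  injective (mx_mnm p).
Proof. by move=> i j /val_inj /enum_val_inj. Qed.

Lemma mx_mnm_surj (F : fieldType) (n : nat) (p : {mpoly F[n + n]})
  (a : 'X_{1..n}) : (mdeg a < msize p)%N -> exists i, mx_mnm p i = a.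
Proof.
by move=> lta; exists (enum_rank (BMultinom lta)); rewrite /mx_mnm enum_rankK.
Qed.

Lemma mnm_pair_eq (n : nat) (a b c d : 'X_{1..n}) :
  (mnm_pair a b == mnm_pair c d) = (a == c) && (b == d).
Proof.
apply/eqP/andP => [eq_abcd|[/eqP-> /eqP->]] //; split; apply/eqP/mnmP => i.
  have := congr1 (fun m : 'X_{1..n + n} => m (lshift n i)) eq_abcd.
  by rewrite !mnmE (unsplitK (inl i)).
have := congr1 (fun m : 'X_{1..n + n} => m (rshift n i)) eq_abcd.
by rewrite !mnmE (unsplitK (inr i)).
Qed.

Lemma bicoef_support (F : fieldType) (n : nat) (p : {mpoly F[n + n]})
  (a b : 'X_{1..n}) : bicoef p a b != 0 ->
  exists i j, a = mx_mnm p i /\ b = mx_mnm p j.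
Proof.
move=> nz_ab.
have [|/(bicoef_eq0l b) ab0] := ltnP (mdeg a) (msize p);
  last by rewrite ab0 eqxx in nz_ab.
have [|/(bicoef_eq0r a) ab0] := ltnP (mdeg b) (msize p);
  last by rewrite ab0 eqxx in nz_ab.
by move=> /mx_mnm_surj[j <-] /mx_mnm_surj[i <-]; exists i, j.
Qed.

(** Truncation loses nothing: by [bicoef_support] every nonzero coefficient is an entry of the
    finite matrix. *)
Lemma sum_coef_mx (F : fieldType) (n : nat) (p : {mpoly F[n + n]}) :
  p = \sum_i \sum_j coef_mx p i j *: 'X_[mnm_pair (mx_mnm p i) (mx_mnm p j)].
Proof.
apply/mpolyP => m; have [a [b ->]] := mnm_pair_surj m; rewrite -/(bicoef p a b).
rewrite raddf_sum /=; under eq_bigr => i _.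
  rewrite raddf_sum /=; under eq_bigr => j _ do
    rewrite mcoeffZ mcoeffX mnm_pair_eq mxE -!/(mx_mnm p _).
  over.
have [ab0|/bicoef_support[i0 [j0 [-> ->]]]] := eqVneq (bicoef p a b) 0.
  rewrite ab0 big1 // => i _; rewrite big1 // => j _.
  by case: andP => [[/eqP-> /eqP->]|_]; rewrite ?ab0 ?mul0r ?mulr0.
rewrite (big_only1 i0) // => [|i ne _].
  rewrite (big_only1 j0) ?eqxx ?mulr1 // => j ne _.
  by rewrite (inj_eq (@mx_mnm_inj _ _ _)) andbC (negPf ne) mulr0.
by rewrite big1 // => j _; rewrite (inj_eq (@mx_mnm_inj _ _ _)) (negPf ne) mulr0.
Qed.

Lemma kroneckerE (F : fieldType) (N n : nat) (p : {mpoly F[n + n]}) :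
  kronecker F N n p = \sum_i \sum_j (coef_mx p i j)%:P%:P *
    (('X^(kronecker_exp N (mx_mnm p i)))%:P * 'X^(kronecker_exp N (mx_mnm p j))).
Proof.
rewrite {1}[p]sum_coef_mx raddf_sum; apply: eq_bigr => i _.
rewrite raddf_sum; apply: eq_bigr => j _.
by rewrite -kroneckerX /kronecker /= mmapZ.
Qed.

(** Indices of the matrix have degree below [N], so distinct monomials of [p] never merge. The outer
    coefficient, in t, selects the column [j]; the inner one, in s, the row [i]. *)
Lemma coef_kronecker (F : fieldType) (N n : nat) (p : {mpoly F[n + n]}) i j :
  (msize p <= N)%N ->
  (kronecker F N n p)`_(kronecker_exp N (mx_mnm p j))`_(kronecker_exp N (mx_mnm p i))
  = coef_mx p i j.
Proof.
move=> le_pN; set e := fun i => kronecker_exp N (mx_mnm p i).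
have e_inj : injective e.
  by move=> k l /kronecker_exp_inj eq_kl; apply/mx_mnm_inj/eq_kl;
    rewrite (leq_trans _ le_pN) // bmdeg.
have coefE k l : (((coef_mx p k l)%:P%:P * (('X^(e k))%:P * 'X^(e l)))`_(e j))`_(e i)
    = coef_mx p k l * ((i == k) && (j == l))%:R.
  rewrite !coefCM coefXn !(inj_eq e_inj) andbC.
  by case: (j == l); rewrite ?mulr1 ?mulr0 ?coef0 ?mulr0 // coefXn (inj_eq e_inj).
rewrite kroneckerE !coef_sum (big_only1 i) // => [|k ne _].
  rewrite !coef_sum (big_only1 j) // => [|l ne _]; first by rewrite coefE !eqxx mulr1.
  by rewrite coefE [j == l]eq_sym andbC (negPf ne) mulr0.
rewrite !coef_sum big1 // => l _.
by rewrite coefE eq_sym (negPf ne) mulr0.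
Qed.

(** To be used with [D] = F[s]. The induction on [rs] varies both [P] and [Q], since each linear
    factor may come off either of them. *)
Lemma factor_of_split_separated (F : fieldType) (D : idomainType)
  (f : {rmorphism F -> D}) (rs : seq F) (A : D) (P Q : {poly D}) :
  A != 0 -> P * Q = A *: map_poly f (\prod_(r <- rs) ('X - r%:P)) ->
  exists (a : D) (b : {poly F}), P = a *: map_poly f b.
Proof.
move=> nzA; elim: rs P Q => [|r rs IHrs] P Q.
  rewrite big_nil rmorph1 => defPQ.
  (* The product is the nonzero constant [A], and degrees add over a domain. *)
  have /size_poly1P[a _ ->] : size P == 1%N.
    have : size (P * Q) == 1%N by rewrite defPQ alg_polyC size_polyC nzA.
    by rewrite size_mul_eq1 => /andP[].
  by exists a, 1; rewrite rmorph1 alg_polyC.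
rewrite big_cons rmorphM /= map_polyXsubC scalerAr => defPQ.
have : root (P * Q) (f r) by rewrite defPQ rootM root_XsubC eqxx.
have nz_lin : 'X - (f r)%:P != 0 by rewrite polyXsubC_eq0.
rewrite rootM => /orP[] /factor_theorem[T defT]; move: defPQ; rewrite defT.
  rewrite mulrAC mulrC => /(mulfI nz_lin) /IHrs[a [b ->]].
  exists a, (b * ('X - r%:P)).
  by rewrite rmorphM /= map_polyXsubC scalerAl.
(* Here the linear factor comes off [Q], so [P] itself is unchanged. *)
by rewrite mulrA mulrC => /(mulfI nz_lin) /IHrs.
Qed.

Lemma factor_of_separated (F : closedFieldType) (D : idomainType)
  (f : {rmorphism F -> D}) (A : D) (B : {poly F}) (P Q : {poly D}) :
  P * Q != 0 -> P * Q = A *: map_poly f B ->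
  exists (a : D) (b : {poly F}), P = a *: map_poly f b.
Proof.
have [rs ->] := closed_field_poly_normal B.
rewrite map_polyZ scalerA => nzPQ defPQ.
(* The leading coefficient of [B] has been absorbed into the scalar, which is nonzero because
   [P * Q] is. *)
apply: (factor_of_split_separated _ defPQ).
by apply: contraNneq nzPQ => A0; rewrite defPQ A0 scale0r.
Qed.

Lemma mrank_eq0 (F : fieldType) (n : nat) (p : {mpoly F[n + n]}) :
  (mrank p == 0)%N = (p == 0).
Proof.
rewrite mxrank_eq0; apply/eqP/eqP => [M0|p0]; last first.
  by rewrite p0; apply/matrixP => i j; rewrite !mxE /bicoef mcoeff0.
rewrite [p]sum_coef_mx M0 big1 // => i _; rewrite big1 // => j _.
by rewrite mxE scale0r.
Qed.

Lemma kronecker_separated (F : fieldType) (N n : nat) (p : {mpoly F[n + n]}) :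
  mrank p = 1%N -> exists A B, kronecker F N n p = A *: map_poly polyC B.
Proof.
move=> rk1.
(* A rank factorization at rank 1: one column times one row. *)
have [x [y defM]] : exists (x : 'cV_ _) (y : 'rV_ _), coef_mx p = x *m y.
  move: (col_base (coef_mx p)) (row_base (coef_mx p)) (mulmx_base (coef_mx p)).
  by rewrite -/(mrank p) rk1 => x y <-; exists x, y.
exists (\sum_i x i 0 *: 'X^(kronecker_exp N (mx_mnm p i))),
  (\sum_j y 0 j *: 'X^(kronecker_exp N (mx_mnm p j))).
rewrite kroneckerE scaler_suml; apply: eq_bigr => i _.
rewrite rmorph_sum scaler_sumr; apply: eq_bigr => j _ /=.
rewrite defM mxE big_ord1 map_polyZ /= map_polyXn -!mul_polyC !rmorphM /=.
by rewrite mulrACA.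
Qed.

(** Reading coefficients off a separated image shows [coef_mx p] to be a column times a row, so its
    rank is at most 1. *)
Lemma mrank_separated (F : fieldType) (N n : nat) (p : {mpoly F[n + n]})
  (A B : {poly F}) : (msize p <= N)%N -> p != 0 ->
  kronecker F N n p = A *: map_poly polyC B -> mrank p = 1%N.
Proof.
move=> le_pN nzp defp; apply/eqP; rewrite eqn_leq lt0n mrank_eq0 nzp andbT.
pose e i := kronecker_exp N (mx_mnm p i).
have -> : mrank p = \rank ((\col_i A`_(e i)) *m (\row_j B`_(e j))).
  congr (\rank _); apply/matrixP => i j.
  rewrite -(coef_kronecker i j le_pN) defp coefZ coef_map coefMC.
  by rewrite mxE big_ord1 !mxE.
exact: leq_trans (mxrankM_maxl _ _) (rank_leq_col _).
Qed.

Lemma mrank_mul_eq1l (F : closedFieldType) (n : nat) (p q : {mpoly F[n + n]}) :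
  mrank (p * q) = 1%N -> mrank p = 1%N.
Proof.
move=> rk1; have nzpq : p * q != 0 by rewrite -mrank_eq0 rk1.
have nzp : p != 0 by apply: contraNneq nzpq => ->; rewrite mul0r.
(* Large enough to keep the image of [p * q] nonzero and to recover the matrix of [p] from its
   image. *)
pose N := maxn (msize p) (msize (p * q)).
have [A [B defPQ]] := kronecker_separated N rk1.
have nzPQ : kronecker F N n (p * q) != 0.
  apply: contraNneq nzpq => PQ0; rewrite -mrank_eq0 mxrank_eq0.
  apply/eqP/matrixP => i j.
  by rewrite -(@coef_kronecker _ N) ?leq_maxr // PQ0 !coef0 mxE.
rewrite rmorphM in defPQ nzPQ.
have [a [b defP]] := factor_of_separated nzPQ defPQ.
exact: mrank_separated (leq_maxl _ _) nzp defP.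
Qed.

Theorem proposition2p2 (R : realType) (n : nat) (p q : {mpoly R[i][n + n]})
  (hp : hermitian_symmetric p) (hq : hermitian_symmetric q)
  (hpq : mrank (p * q) = 1%N) :
  mrank p = 1%N /\ mrank q = 1%N.
Proof.
split; first exact: mrank_mul_eq1l hpq.
by rewrite mulrC in hpq; apply: mrank_mul_eq1l hpq.
Qed.
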